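(* Let $L$ be a finite geometric lattice of rank $r$ with graded Möbius algebra $B(L)$, and let $v_0,\dots,v_r\in B(L)$ be defined by $v_k=u^k$, where $u=\sum_{a\in A}e_a$. The subspace \[ \mathcal R(L):=\mathrm{span}\{v_0,\ldots,v_r\}\subseteq B(L) \] is a graded subalgebra, and the map \[ \mathbb R[t]/(t^{r+1})\longrightarrow\mathcal R(L),\qquad t^k\longmapsto v_k, \] is an isomorphism of graded algebras.
   Context: $L$ has atom set $A$, rank function $\mathrm{rk}$ and bottom element $\hat 0$. The graded Möbius algebra $B(L)$ is the real vector space $\mathbb R[L]$ with basis $(e_x)_{x\in L}$ and product \[ e_x\diamond e_y=\begin{cases}e_{x\vee y},&\mathrm{rk}(x)+\mathrm{rk}(y)=\mathrm{rk}(x\vee y),\\0,&\text{otherwise},\end{cases} \] graded by placing $e_x$ in degree $\mathrm{rk}(x)$; its unit is $e_{\hat 0}$. The power $u^k$ is taken in $B(L)$ (with $u^0=e_{\hat 0}$). The variable $t$ has degree $1$. *)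

(* Defs.v *)
From HB Require Import structures.
From mathcomp Require Import all_boot all_order all_algebra all_field.
From mathcomp Require Import reals.

Set Implicit Arguments.
Unset Strict Implicit.
Unset Printing Implicit Defensive.

Import Order.TTheory GRing.Theory.
Local Open Scope ring_scope.

Section LatticeRank.
Context {d : Order.disp_t} {L : finTBLatticeType d}.
Local Open Scope order_scope.

Definition covers (x y : L) := (x < y) && [forall z, ~~ (x < z < y)].

Definition atom (a : L) := covers \bot a.

Definition chain (C : {set L}) :=
  [forall x in C, forall y in C, x >=< y].

(* The length (number of elements minus one) of a longest chain in the
   interval from \bot to x; in a graded lattice this is the rank of x. *)
Definition rank (x : L) : nat :=
  (\max_(C : {set L} | chain C && [forall y in C, (y <= x)%O]) #|C|).-1.

End LatticeRank.

(* Geometric = atomistic, graded by rank, and semimodular. *)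
HB.mixin Record isGeometric (d : Order.disp_t) L
    of Order.FinTBLattice d L := {
  atomistic : forall x : L, exists S : {set L},
    (forall a, a \in S -> atom a) /\ x = (\join_(a in S) a)%O;
  rank_covers : forall x y : L, covers x y -> rank y = (rank x).+1;
  rank_submodular : forall x y : L,
    (rank (x `&` y)%O + rank (x `|` y)%O <= rank x + rank y)%N
}.

#[short(type="geomLatticeType")]
HB.structure Definition GeomLattice (d : Order.disp_t) :=
  { L of isGeometric d L & Order.FinTBLattice d L }.

Section LatticeRankTheory.
Context {d : Order.disp_t}.

Lemma rank0 (L : finTBLatticeType d) : rank (\bot%O : L) = 0%N.
Proof.
rewrite /rank; set m := (\max_(C | _) _)%N.
suff : (m <= 1)%N by case: m => [|[]].
apply/bigmax_leqP => C /andP[_ /forall_inP C0].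
rewrite -(cards1 (\bot%O : L)); apply/subset_leq_card/subsetP => x /C0.
by rewrite inE lex0.
Qed.

Lemma rank_join (L : geomLatticeType d) (x y : L) :
  (rank (x `|` y)%O <= rank x + rank y)%N.
Proof. exact: leq_trans (leq_addl _ _) (rank_submodular x y). Qed.

End LatticeRankTheory.

(* The element f stands for \sum_x f x *: e_x. *)
Definition mobius_alg (R : fieldType) (d : Order.disp_t)
  (L : geomLatticeType d) : Type := {ffun L -> R^o}.

HB.instance Definition _ (R : fieldType) d (L : geomLatticeType d) :=
  Vector.copy (mobius_alg R L) {ffun L -> R^o}.

Section MobiusAlgebra.
Context {R : fieldType} {d : Order.disp_t} {L : geomLatticeType d}.
Local Notation B := (mobius_alg R L).
Implicit Types (x y z : L) (f g h : B).

Definition mob_e (x : L) : B := [ffun y => (y == x)%:R].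

Definition mob_e_mul x y : B :=
  if (rank x + rank y == rank (x `|` y)%O)%N then mob_e (x `|` y)%O else 0.

Definition mob_mul (f g : B) : B :=
  \sum_(x : L) \sum_(y : L) (f x * g y) *: mob_e_mul x y.

Lemma mob_sum_e f : f = \sum_x f x *: mob_e x.
Proof.
apply/ffunP => y; rewrite sum_ffunE (bigD1 y) //= big1 => [|x /negPf nxy].
  by rewrite !ffunE eqxx addr0 /GRing.scale /= mulr1.
by rewrite !ffunE eq_sym nxy scaler0.
Qed.

Fact mob_mulC : commutative mob_mul.
Proof.
move=> f g; rewrite /mob_mul exchange_big; apply: eq_bigr => x _.
by apply: eq_bigr => y _; rewrite mulrC /mob_e_mul addnC joinC.
Qed.

Fact mob_mulDl : left_distributive mob_mul +%R.
Proof.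
move=> f g h; rewrite /mob_mul -big_split; apply: eq_bigr => x _ /=.
by rewrite -big_split; apply: eq_bigr => y _ /=; rewrite ffunE mulrDl scalerDl.
Qed.

Fact mob_scaleAl (a : R) f g : a *: mob_mul f g = mob_mul (a *: f) g.
Proof.
rewrite /mob_mul scaler_sumr; apply: eq_bigr => x _.
rewrite scaler_sumr; apply: eq_bigr => y _.
by rewrite ffunE scalerA mulrA.
Qed.

Lemma mob_mul_sumZl (c : L -> R) (F : L -> B) g :
  mob_mul (\sum_x c x *: F x) g = \sum_x c x *: mob_mul (F x) g.
Proof.
have m0 : mob_mul 0 g = 0.
  by rewrite -[X in mob_mul X](scale0r (0 : B)) -mob_scaleAl scale0r.
have := big_morph (mob_mul^~ g) (fun f h => mob_mulDl f h g) m0.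
move=> ->; by apply: eq_bigr => x _; rewrite mob_scaleAl.
Qed.

Lemma mob_mul_sumZr (c : L -> R) (F : L -> B) f :
  mob_mul f (\sum_x c x *: F x) = \sum_x c x *: mob_mul f (F x).
Proof.
rewrite mob_mulC mob_mul_sumZl; apply: eq_bigr => x _.
by rewrite mob_mulC.
Qed.

Lemma mob_mul_e x y : mob_mul (mob_e x) (mob_e y) = mob_e_mul x y.
Proof.
rewrite /mob_mul (bigD1 x) //= [X in _ + X]big1 => [|z /negPf nzx].
  rewrite addr0 (bigD1 y) //= big1 => [|z /negPf nzy].
    by rewrite !ffunE !eqxx mulr1 scale1r addr0.
  by rewrite !ffunE nzy mulr0 scale0r.
by apply: big1 => t _; rewrite !ffunE nzx mul0r scale0r.
Qed.

Lemma mob_mul0 f : mob_mul 0 f = 0.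
Proof. by rewrite -[X in mob_mul X](scale0r (0 : B)) -mob_scaleAl scale0r. Qed.

Lemma mob_e_mulA_l x y z :
  mob_mul (mob_e_mul x y) (mob_e z) =
  if (rank x + rank y + rank z == rank (x `|` y `|` z)%O)%N
  then mob_e (x `|` y `|` z)%O else 0.
Proof.
rewrite {1}/mob_e_mul; have [exy|nxy] := eqVneq.
  by rewrite mob_mul_e /mob_e_mul exy.
rewrite mob_mul0; case: eqP => // e; case/eqP: nxy.
apply/eqP; rewrite eqn_leq rank_join andbT -(leq_add2r (rank z)) e.
exact: rank_join.
Qed.

Fact mob_mulA : associative mob_mul.
Proof.
move=> f g h.
rewrite (mob_sum_e f) (mob_sum_e g) (mob_sum_e h).
rewrite !mob_mul_sumZl; apply: eq_bigr => x _; congr (_ *: _).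
rewrite [LHS]mob_mul_sumZr [mob_mul (mob_e x) (\sum_y _)]mob_mul_sumZr.
rewrite mob_mul_sumZl.
apply: eq_bigr => y _; congr (_ *: _).
rewrite !mob_mul_sumZr; apply: eq_bigr => z _; congr (_ *: _).
rewrite !mob_mul_e mob_e_mulA_l mob_mulC mob_e_mulA_l.
by rewrite [(_ `|` x)%O]joinC joinA addnC addnA.
Qed.

Fact mob_mul1 : left_id (mob_e \bot%O) mob_mul.
Proof.
move=> f; rewrite {1}(mob_sum_e f) mob_mul_sumZr [RHS]mob_sum_e.
apply: eq_bigr => x _; congr (_ *: _).
by rewrite mob_mul_e /mob_e_mul join0x rank0 add0n eqxx.
Qed.

Fact mob_e0_neq0 : mob_e \bot%O != 0.
Proof.
apply/eqP => /ffunP/(_ \bot%O); rewrite !ffunE eqxx.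
by move/eqP; rewrite oner_eq0.
Qed.

HB.instance Definition _ := GRing.Zmodule_isComNzRing.Build B
  mob_mulA mob_mulC mob_mul1 mob_mulDl mob_e0_neq0.
HB.instance Definition _ := GRing.Lmodule_isLalgebra.Build R B mob_scaleAl.

Fact mob_scaleAr (a : R) f g : a *: (f * g) = f * (a *: g).
Proof. by rewrite mulrC scalerAl mulrC. Qed.

HB.instance Definition _ := GRing.Lalgebra_isAlgebra.Build R B mob_scaleAr.
HB.instance Definition _ := Algebra_isFalgebra.Build R B.

Lemma mob_e1 : mob_e \bot%O = 1 :> B.
Proof. by []. Qed.

Lemma mob_eM x y : mob_e x * mob_e y =
  if (rank x + rank y == rank (x `|` y)%O)%N then mob_e (x `|` y)%O else 0.
Proof. exact: mob_mul_e. Qed.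

Definition mob_grade (k : nat) : {vspace B} :=
  (\sum_(x : L | rank x == k) <[mob_e x]>)%VS.

End MobiusAlgebra.

Arguments mobius_alg R {d} L.
Arguments mob_e R {d L} x.
Arguments mob_grade R {d} L k.

HB.instance Definition _ (R : fieldType) (h : {poly R}) :=
  GRing.UnitAlgebra.on {poly %/ h}.
HB.instance Definition _ (R : fieldType) (h : {poly R}) :=
  Vector.on {poly %/ h}.

(* R[t]/(t^n), for n > 0 *)
Definition trunc_poly (R : fieldType) (n : nat) : falgType R :=
  {poly %/ ('X^n : {poly R})}.

Definition trunc_t {R : fieldType} {n : nat} : trunc_poly R n :=
  qpolyX 'X^n.

(* For k >= n > 0 this is the zero space, since then trunc_t ^+ k = 0. *)
Definition trunc_grade (R : fieldType) (n k : nat) :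
  {vspace trunc_poly R n} := <[trunc_t ^+ k]>%VS.

Section Graded.
Context {F : fieldType}.

(* In the next two definitions G k is the degree k component of A. *)
Definition graded_subspace (A : vectType F) (G : nat -> {vspace A})
    (U : {vspace A}) : Prop :=
  exists n, U = (\sum_(k < n) (U :&: G k))%VS.

Definition graded_subalgebra (A : falgType F) (G : nat -> {vspace A})
    (U : {vspace A}) : Prop :=
  [/\ 1 \in U, (U * U <= U)%VS & graded_subspace G U].

(* f is an isomorphism of graded algebras from A onto the graded
   subalgebra U of B. *)
Definition graded_iso_onto (A B : falgType F) (GA : nat -> {vspace A})
    (GB : nat -> {vspace B}) (U : {vspace B}) (f : 'AHom(A, B)) : Prop :=
  [/\ lker f == 0%VS, limg f = U &
      forall k, (f @: GA k)%VS = (U :&: GB k)%VS].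

End Graded.

(* Main.v *)
Require Import Defs.
From HB Require Import structures.
From mathcomp Require Import all_boot all_order all_algebra all_field.
From mathcomp Require Import reals.

Set Implicit Arguments.
Unset Strict Implicit.
Unset Printing Implicit Defensive.

Import Order.TTheory GRing.Theory Num.Theory.
Local Open Scope ring_scope.

(** The element u, being a sum of atoms, is homogeneous of degree 1, so u ^+ k
    is homogeneous of degree k, and u ^+ k = 0 as soon as k exceeds the rank r
    of L ([mob_grade_gt]). Hence t |-> u extends to an algebra morphism f from
    R[t]/(t^(r+1)) ([trunc_ahom]) whose image is the span of the powers of u;
    this makes the span a subalgebra, graded because its generators are
    homogeneous.

    The combinatorial input is that u ^+ r is not zero. The coefficient of
    u ^+ k at an element x of rank k is the number of sequences of k atoms with
    join x, and there is at least one: x covers some y, and adding to y an atom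
    below x but not below y gives back x. Formally, all coefficients of powers
    of u are nonnegative, and induction along a maximal chain below x shows that
    this one is positive ([atom_sumX_gt0]). Since u ^+ k divides u ^+ r for
    k <= r, none of these powers vanishes.

    Injectivity of f, and the fact that f maps each degree onto the matching
    homogeneous part of its image, both follow from reading coordinates: as
    u ^+ k is supported on the elements of rank k, the coefficient at x of the
    value of f at a polynomial q involves only the coefficient of q of index
    rank x. *)

(** * Ranks and covers in a geometric lattice *)

Section Lattice.
Context {d : Order.disp_t} {L : geomLatticeType d}.
Implicit Types x y a : L.
Local Open Scope order_scope.

Lemma rank_mono x y : x <= y -> (rank x <= rank y)%N.
Proof.
move=> xy; rewrite /rank -!subn1; apply: leq_sub2r.
apply/bigmax_leqP => C /andP[chC /forall_inP Cx].
apply: (@leq_bigmax_cond _ _ (fun C : {set L} => #|C|)); rewrite chC.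
by apply/forall_inP => z /Cx zx; apply: le_trans xy.
Qed.

Lemma rank_atom a : atom a -> rank a = 1%N.
Proof. by move/rank_covers => ->; rewrite rank0. Qed.

(** An element y < x with as many elements below it as possible is covered
    by x. *)
Lemma exists_covered x : x != \bot -> exists y, covers y x.
Proof.
rewrite -lt0x => x0.
case: (@arg_maxnP _ \bot (fun y => y < x) (fun y => #|[set z | z <= y]|) x0).
move=> y yx maxy; exists y; rewrite /covers yx; apply/forallP => z.
apply/negP => /andP[yz /maxy]; rewrite /= leqNgt => /negP; apply.
apply: proper_card; apply/properP; split.
  by apply/subsetP => t; rewrite !inE => ty; apply: le_trans (ltW yz).
by exists z; rewrite !inE ?lexx // lt_geF.
Qed.

(** If every atom below x were below y, then x, a join of such atoms, would be
    below y. An atom a below x but not below y gives y < y `|` a <= x, and the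
    covering relation leaves only equality. *)
Lemma covers_joinP x y : covers y x -> exists2 a, atom a & y `|` a = x.
Proof.
case/andP => yx /forallP nz; have [S [atS xS]] := atomistic x.
have /exists_inP[a aS nay] : [exists a in S, ~~ (a <= y)].
  apply: contraLR yx => /exists_inPn ay; rewrite le_gtF // xS.
  by apply/joinsP => a /ay; rewrite negbK.
exists a; first exact: atS.
have ax : a <= x by rewrite xS; apply: (joins_sup id).
have := nz (y `|` a); rewrite lt_leAnge leUl leUx lexx nay /=.
by rewrite lt_neqAle leUx (ltW yx) ax /= andbT negbK => /eqP.
Qed.

End Lattice.

(** * Homogeneous elements of the graded Moebius algebra *)

Section Mobius.
Context {R : fieldType} {d : Order.disp_t} {L : geomLatticeType d}.
Implicit Types (f g : mobius_alg R L) (x : L).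

Lemma mob_mul_coef f g x : (f * g) x = \sum_y \sum_z
  f y * g z * ((rank y + rank z == rank x)%N && (y `|` z == x)%O)%:R.
Proof.
rewrite [f * g]/(mob_mul f g) /mob_mul sum_ffunE; apply: eq_bigr => y _.
rewrite sum_ffunE; apply: eq_bigr => z _; rewrite ffunE; congr (_ * _).
rewrite /mob_e_mul; have [<-|nx] := eqVneq (y `|` z)%O x.
  by case: ifP => _; rewrite !ffunE ?eqxx.
by case: ifP => _; rewrite !ffunE ?andbF // eq_sym (negPf nx).
Qed.

Lemma mob_gradeP k f :
  reflect (forall x, rank x != k -> f x = 0) (f \in mob_grade R L k).
Proof.
apply: (iffP idP) => [/memv_sumP[g gP ->] x xk|f0].
  rewrite sum_ffunE big1 // => y yk.
  have /vlineP[c ->] := gP y yk; rewrite !ffunE.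
  case: eqP => [xy|_]; last by rewrite scaler0.
  by rewrite xy yk in xk.
rewrite [f]mob_sum_e; apply: memv_suml => x _.
have [xk|/f0 ->] := eqVneq (rank x) k; last by rewrite scale0r mem0v.
by apply/memvZ/(subvP (sumv_sup x _ (subvv _))); rewrite ?xk // memv_line.
Qed.

Lemma mob_gradeM j k f g :
  f \in mob_grade R L j -> g \in mob_grade R L k ->
  f * g \in mob_grade R L (j + k).
Proof.
move=> /mob_gradeP fj /mob_gradeP gk; apply/mob_gradeP => x xjk.
rewrite mob_mul_coef big1 // => y _; rewrite big1 // => z _.
have [yj|/fj ->] := eqVneq (rank y) j; last by rewrite !mul0r.
have [zk|/gk ->] := eqVneq (rank z) k; last by rewrite mulr0 mul0r.
by rewrite yj zk eq_sym (negPf xjk) mulr0.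
Qed.

Lemma mob_gradeX k f : f \in mob_grade R L 1 -> f ^+ k \in mob_grade R L k.
Proof.
move=> f1; elim: k => [|k IHk]; last by rewrite exprS -add1n mob_gradeM.
apply/mob_gradeP => x x0; rewrite expr0 -mob_e1 ffunE.
by have [xb|//] := eqVneq x \bot%O; rewrite xb rank0 in x0.
Qed.

Lemma mob_grade_gt k f : (rank (\top%O : L) < k)%N ->
  f \in mob_grade R L k -> f = 0.
Proof.
move=> rk /mob_gradeP f0; apply/ffunP => x; rewrite ffunE f0 //.
by rewrite ltn_eqF // (leq_ltn_trans _ rk) // rank_mono ?lex1.
Qed.

End Mobius.

(** * Morphisms out of truncated polynomials *)

Section HornerAlg.
Context {R : fieldType}.

Lemma horner_alg_wide (A : algType R) (a : A) n (p : {poly R}) :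
  (size p <= n)%N -> horner_alg a p = \sum_(i < n) p`_i *: a ^+ i.
Proof.
move=> pn; have {1}-> : p = \poly_(i < n) p`_i.
  apply/polyP => i; rewrite coef_poly; case: ltnP => // ni.
  by rewrite nth_default // (leq_trans pn).
rewrite poly_def linear_sum; apply: eq_bigr => i _.
by rewrite linearZ rmorphXn /= horner_algX mulr_algl.
Qed.

(** The carrier of [trunc_poly] consists of remainders modulo the monic
    polynomial [mk_monic 'X^(n.+1)], which is 'X^(n.+1) itself. *)
Lemma size_trunc_poly n (q : trunc_poly R n.+1) :
  (size (q : {poly R}) <= n.+1)%N.
Proof.
by rewrite -ltnS (leq_trans (size_mk_monic _)) // mk_monic_Xn size_polyXn.
Qed.

Section TruncHorner.
Variables (A : falgType R) (a : A) (n : nat).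
Hypothesis an : a ^+ n.+1 = 0.

(** Reducing a polynomial modulo 'X^(n.+1) changes it by a multiple of
    'X^(n.+1), which evaluates to 0 at a. *)
Lemma horner_alg_rmod (p : {poly R}) :
  horner_alg a (Pdiv.Ring.rmodp p (mk_monic 'X^(n.+1))) = horner_alg a p.
Proof.
rewrite [p in RHS](Pdiv.RingMonic.rdivp_eq (monic_mk_monic 'X^(n.+1))).
rewrite rmorphD rmorphM /= [X in _ * horner_alg a X]mk_monic_Xn rmorphXn /=.
by rewrite horner_algX an mulr0 add0r.
Qed.

Definition trunc_horner (q : trunc_poly R n.+1) : A :=
  horner_alg a (q : {poly R}).

Lemma trunc_horner_linear : linear trunc_horner.
Proof.
move=> c p q; rewrite /trunc_horner.
have -> : (c *: p + q : trunc_poly R n.+1) =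
  c *: (p : {poly R}) + q :> {poly R} by [].
by rewrite linearP /= mulr_algl.
Qed.

Lemma trunc_horner_monoid : monoid_morphism trunc_horner.
Proof.
split=> [|p q]; rewrite /trunc_horner; first exact: rmorph1 (horner_alg a).
by rewrite horner_alg_rmod rmorphM.
Qed.

HB.instance Definition _ := GRing.isLinear.Build R (trunc_poly R n.+1) A _
  trunc_horner trunc_horner_linear.
HB.instance Definition _ := GRing.isMonoidMorphism.Build (trunc_poly R n.+1) A
  trunc_horner trunc_horner_monoid.

Definition trunc_ahom : 'AHom(trunc_poly R n.+1, A) :=
  linfun_ahom trunc_horner.

Lemma trunc_ahomE q :
  trunc_ahom q = \sum_(i < n.+1) (q : {poly R})`_i *: a ^+ i.
Proof.
by rewrite lfunE /= /trunc_horner (horner_alg_wide _ (size_trunc_poly q)).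
Qed.

Lemma trunc_ahomX k : trunc_ahom (trunc_t ^+ k) = a ^+ k.
Proof.
rewrite lfunE rmorphXn /= /trunc_horner /trunc_t horner_alg_rmod.
by rewrite horner_algX.
Qed.
End TruncHorner.
End HornerAlg.

(** * Powers of the sum of the atoms *)

Section AtomSum.
Context {R : numFieldType} {d : Order.disp_t} {L : geomLatticeType d}.
Implicit Types x : L.

Let u : mobius_alg R L := \sum_(a : L | atom a) mob_e R a.

Lemma atom_sum_coef x : u x = (atom x)%:R.
Proof.
rewrite sum_ffunE; have [ax|nax] := boolP (atom x).
  rewrite (bigD1 x) //= big1 ?addr0 => [|a /andP[_ /negPf ax']].
    by rewrite ffunE eqxx.
  by rewrite ffunE eq_sym ax'.
rewrite big1 // => a aa; rewrite ffunE; case: eqP => // xa.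
by rewrite xa aa in nax.
Qed.

Lemma atom_sum_grade : u \in mob_grade R L 1.
Proof.
apply/mob_gradeP => x x1; rewrite atom_sum_coef.
by case: (boolP (atom x)) x1 => // /rank_atom ->.
Qed.

Lemma atom_sumX_ge0 k x : 0 <= (u ^+ k) x.
Proof.
elim: k x => [|k IHk] x; first by rewrite expr0 -mob_e1 ffunE ler0n.
rewrite exprSr mob_mul_coef; apply: sumr_ge0 => y _; apply: sumr_ge0 => z _.
by rewrite atom_sum_coef !mulr_ge0 ?ler0n.
Qed.

(** Induction on the rank: if x covers y and x = y `|` a for an atom a, then the
    pair (y, a) contributes the coefficient of u ^+ rank y at y to that of
    u ^+ rank x at x, and no other pair contributes negatively. *)
Lemma atom_sumX_gt0 x : 0 < (u ^+ rank x) x.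
Proof.
suff pos k : forall y, rank y = k -> 0 < (u ^+ k) y by exact: pos.
elim: k {x} => [|k IHk] x xk.
  have [-> |/exists_covered[y /rank_covers]] := eqVneq x \bot%O.
    by rewrite expr0 -mob_e1 ffunE eqxx ltr01.
  by rewrite xk.
have /exists_covered[y yx] : x != \bot%O.
  by apply: contra_eq_neq xk => ->; rewrite rank0.
have [a aa yax] := covers_joinP yx.
have yk : rank y = k by have := rank_covers _ _ yx; rewrite xk => -[].
(* Isolate the contribution of (y, a) from the nonnegative remainder. *)
rewrite exprSr mob_mul_coef (bigD1 y) //= (bigD1 a) //= -addrA.
rewrite ltr_wpDr //.
  by apply: addr_ge0; apply: sumr_ge0 => *; rewrite ?sumr_ge0 // => *;
     rewrite !mulr_ge0 ?ler0n ?atom_sumX_ge0 // atom_sum_coef ler0n.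
by rewrite atom_sum_coef aa yk (rank_atom aa) xk addn1 yax !eqxx !mulr1 IHk.
Qed.

End AtomSum.

Theorem proposition2p1 (R : realType) (d : Order.disp_t)
    (L : geomLatticeType d) (r : nat) (rkL : rank (\top%O : L) = r) :
  let u : mobius_alg R L := \sum_(a : L | atom a) mob_e R a in
  let v (k : nat) := u ^+ k in
  let RL := <<[seq v k | k <- iota 0 r.+1]>>%VS in
  graded_subalgebra (mob_grade R L) RL /\
  exists f : 'AHom(trunc_poly R r.+1, mobius_alg R L),
    (forall k, (k <= r)%N -> f (trunc_t ^+ k) = v k) /\
    graded_iso_onto (trunc_grade R r.+1) (mob_grade R L) RL f.
Proof.
move=> u v RL.
have vG k : v k \in mob_grade R L k by apply/mob_gradeX/atom_sum_grade.
have v0 k : (r < k)%N -> v k = 0.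
  by move=> rk; apply: (mob_grade_gt _ (vG k)); rewrite rkL.
(* The coefficient of v r at the top is positive, and v k divides v r. *)
have vn0 k : (k <= r)%N -> v k != 0.
  move=> kr; apply/eqP => vk0.
  have : 0 < v r \top%O by rewrite /v -{1}rkL atom_sumX_gt0.
  by rewrite /v -(subnK kr) exprD -/(v k) vk0 mulr0 ffunE ltxx.
pose f := trunc_ahom (v0 r.+1 (ltnSn r)).
have fX k : f (trunc_t ^+ k) = v k by apply: trunc_ahomX.
have rk_lt (x : L) : (rank x < r.+1)%N by rewrite ltnS -rkL rank_mono ?lex1.
(* Among the powers of u, only the one of exponent rank x can be nonzero
   at x. *)
have f_coef q x : f q x = (q : {poly R})`_(rank x) * (v (rank x)) x.
  rewrite trunc_ahomE sum_ffunE (bigD1 (Ordinal (rk_lt x))) //= big1 ?addr0.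
    by rewrite ffunE.
  move=> i ix; rewrite ffunE (mob_gradeP _ _ (vG i)) ?scaler0 //.
  by rewrite eq_sym.
have vRL k : (k <= r)%N -> v k \in RL.
  by move=> kr; rewrite memv_span ?map_f // mem_iota.
(* Images of algebra morphisms are subalgebras, so this identity spares
   computing products of the spanning elements. *)
have limgf : limg f = RL.
  apply/eqP; rewrite eqEsubv; apply/andP; split.
    apply/subvP => _ /memv_imgP[q _ ->]; rewrite trunc_ahomE.
    by apply: memv_suml => i _; rewrite memvZ // vRL // -ltnS.
  by apply/span_subvP => _ /mapP[k _ ->]; rewrite -fX memv_img ?memvf.
split; first split.
- exact: (vRL 0%N).
- by rewrite -limgf -aimgM limgS ?subvf.
- exists r.+1; apply/eqP; rewrite eqEsubv; apply/andP; split; last first.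
    by apply/subv_sumP => k _; apply: capvSl.
  apply/span_subvP => _ /mapP[k kr ->].
  rewrite mem_iota in kr.
  apply: (subvP (sumv_sup (Ordinal kr) _ (subvv _))) => //.
  by rewrite memv_cap vG vRL.
exists f; split=> [k _|]; first exact: fX.
split=> // [|k].
  rewrite -subv0; apply/subvP => q; rewrite memv_ker memv0 => /eqP fq0.
  apply/eqP/val_inj/polyP => k /=; rewrite coef0.
  have [kr|rk] := leqP k r; last first.
    by rewrite nth_default // (leq_trans (size_trunc_poly q)).
  (* Any x in the support of v k has rank k, so the coefficient at x of f q = 0
     is the product of q`_k with a nonzero scalar. *)
  have [x vkx] : exists x, v k x != 0.
    apply/existsP; apply: contraNT (vn0 k kr) => /existsPn vk0.
    by apply/eqP/ffunP => x; rewrite ffunE; apply/eqP/negbNE/vk0.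
  have xk : rank x = k.
    by apply: contraNeq vkx => /(mob_gradeP _ _ (vG k)) ->.
  have /eqP := f_coef q x.
  by rewrite fq0 ffunE xk eq_sym mulf_eq0 (negPf vkx) orbF => /eqP.
apply/eqP; rewrite eqEsubv; apply/andP; split.
  by rewrite limg_line fX -memvE memv_cap vG -limgf -fX memv_img ?memvf.
rewrite -limgf; apply/subvP => _ /memv_capP[/memv_imgP[q _ ->] /mob_gradeP fqk].
(* Outside rank k both sides vanish; in rank k they agree by f_coef. *)
rewrite limg_line fX; apply/vlineP; exists (q : {poly R})`_k.
apply/ffunP => x; rewrite ffunE.
have [xk|xk] := eqVneq (rank x) k; first by rewrite f_coef xk.
by rewrite fqk // (mob_gradeP _ _ (vG k)) ?scaler0.
Qed.
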